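(* Let $X=\mathbb{Z}[\frac12]\cap(0,1)$ with the action of Thompson's group $F$ and root $p=\frac58$. If $f:\mathcal{P}_f(X)\to\mathbb{R}$ is a generalized min-function, then $f$ has an approximation in the strong sense, that is, there is a sequence $\{E_n\}$ in $\mathcal{P}_f(X)$ such that for any $s\in\mathcal{P}_f(X)\rtimes F$ we have $\frac{f(sE_n)}{f(E_n)}\to1$ as $n\to\infty$.
   Context: Thompson's group $F$ is the group of orientation-preserving piecewise linear homeomorphisms of $[0,1]$ with finitely many breakpoints, all dyadic rationals, and all slopes integer powers of $2$; it acts on $X=\mathbb{Z}[\frac12]\cap(0,1)$. It is generated by $a$ and $b$, where $a(x)=2x$ on $[0,\frac14]$, $a(x)=\frac x2+\frac38$ on $[\frac14,\frac34]$, $a(x)=x$ on $[\frac34,1]$; and $b(x)=x$ on $[0,\frac12]$, $b(x)=\frac x2+\frac14$ on $[\frac12,\frac34]$, $b(x)=x-\frac18$ on $[\frac34,\frac78]$, $b(x)=2x-1$ on $[\frac78,1]$. Root: $p=\frac58$. A function $\varphi:X\to\mathbb{R}$ is superharmonic if $\varphi(x)\ge\frac14(\varphi(ax)+\varphi(bx)+\varphi(a^{-1}x)+\varphi(b^{-1}x))$ for all $x\in X$. $\mathcal{P}_f(X)$ is the set of finite subsets of $X$. The lamplighter group $\mathcal{P}_f(X)\rtimes F$ has multiplication $(E,g)(E',h)=(E\,\Delta\,gE',gh)$ and acts on $\mathcal{P}_f(X)$ by $(E,g)(E')=E\,\Delta\,gE'$. Generalized min-functions: let $T$ be the set of sequences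 in $(0,1]^{\mathbb{N}}$ all but finitely many of whose coordinates equal $1$. Let $m$ be a positive integer and $r:(0,1]^m\to(0,\infty)$ a symmetric concave function, non-decreasing in each variable. Define $g:T\to(0,\infty)$ by $g(x)=r(x_{(1)},\dots,x_{(m)})$, where $x_{(1)}\le x_{(2)}\le\cdots$ is the non-decreasing rearrangement of the coordinates of $x$ (so $x_{(1)},\dots,x_{(m)}$ are the $m$ smallest coordinates, with multiplicity). Let $\varphi:X\to(0,1]$ be a superharmonic function achieving its maximum $1$ at $p$. The corresponding generalized min-function is $f(E)=g(\varphi(q_1),\dots,\varphi(q_k),1,1,1,\dots)$ for $E=\{q_1,\dots,q_k\}\in\mathcal{P}_f(X)$ (with $q_i$ distinct; $f(\varnothing)=g(1,1,\dots)$). *)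

(* Defs.v *)
From HB Require Import structures.
From mathcomp Require Import all_boot all_order all_algebra.
From mathcomp Require Import perm finmap.
From mathcomp Require Import all_classical all_reals all_analysis.
From mathcomp Require Import lra ring.
Import numFieldNormedType.Exports.
Import Order.TTheory GRing.Theory Num.Theory.

Set Implicit Arguments.
Unset Strict Implicit.
Unset Printing Implicit Defensive.

Local Open Scope classical_set_scope.
Local Open Scope ring_scope.

Definition dyadic (R : realType) (x : R) : Prop :=
  exists (z : int) (n : nat), x = z%:~R / 2 ^+ n.

Definition X (R : realType) : set R := [set x | 0 < x < 1 /\ dyadic x].
Arguments X R : clear implicits.

(* [g] is piecewise linear on [0, 1] with breakpoints in the finite set [B] of
   dyadic rationals and slopes in 2 ^ Z: on every subinterval of [0, 1] whose
   interior misses [B], [g] is affine with slope an integer power of 2. *)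
Definition dyadic_pl (R : realType) (g : R -> R) : Prop :=
  exists B : seq R, (forall b, b \in B -> dyadic b) /\
    forall u v : R, 0 <= u -> u < v -> v <= 1 ->
      (forall b, b \in B -> ~~ (u < b < v)) ->
      exists k : int, forall x, u <= x <= v -> g x = g u + 2 ^ k * (x - u).

(* A homeomorphism of [0, 1] is encoded, together with its inverse, by its
   extension to [R] that is the identity outside [0, 1]; increasing
   homeomorphisms of [0, 1] fix 0 and 1. *)
Record thompson (R : realType) := Thompson {
  tfun :> R -> R;
  tinv : R -> R;
  tfunK : cancel tfun tinv;
  tinvK : cancel tinv tfun;
  tfun_continuous : continuous tfun;
  tinv_continuous : continuous tinv;
  tfun_lt : {homo tfun : x y / x < y};
  tfun_out : forall x, ~~ (0 < x < 1) -> tfun x = x;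
  tfun_pl : dyadic_pl tfun }.

Section ThompsonTheory.
Variable R : realType.
Implicit Types (x y z : R) (g h : thompson R).

HB.instance Definition _ := gen_eqMixin (thompson R).
HB.instance Definition _ := gen_choiceMixin (thompson R).

Lemma thompsonP g h : g =1 h -> g = h.
Proof.
case: g h => [g g' gK g'K gc g'c gl go gp] [h h' hK h'K hc h'c hl ho hp] /= e.
have eg : g = h by apply/funext.
subst h; have eg' : g' = h'.
  by apply/funext => x; rewrite -[x in LHS]h'K gK.
by subst h'; congr Thompson; exact: Prop_irrelevance.
Qed.

Lemma tinv_lt g : {homo tinv g : x y / x < y}.
Proof.
move=> x y xy; rewrite ltNge; apply/negP; rewrite le_eqVlt => /orP[/eqP e|].
  by move: xy; rewrite -(tinvK g x) -e tinvK ltxx.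
by move=> /(@tfun_lt _ g); rewrite !tinvK => /(lt_trans xy); rewrite ltxx.
Qed.

Lemma tfun_ltE g x y : (g x < g y) = (x < y).
Proof.
by apply/idP/idP => [/(@tinv_lt g)|/(@tfun_lt _ g)//]; rewrite !tfunK.
Qed.

Lemma tfun0 g : g 0 = 0. Proof. by rewrite tfun_out // ltxx. Qed.
Lemma tfun1 g : g 1 = 1. Proof. by rewrite tfun_out // ltxx andbF. Qed.

Lemma tfun_leE g x y : (g x <= g y) = (x <= y).
Proof. by rewrite !leNgt tfun_ltE. Qed.

Lemma tinv_out g x : ~~ (0 < x < 1) -> tinv g x = x.
Proof. by move=> xo; rewrite -{1}(tfun_out g xo) tfunK. Qed.

Lemma tinv0 g : tinv g 0 = 0. Proof. by rewrite tinv_out // ltxx. Qed.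
Lemma tinv1 g : tinv g 1 = 1. Proof. by rewrite tinv_out // ltxx andbF. Qed.

Lemma tinv_ltE g x y : (tinv g x < tinv g y) = (x < y).
Proof. by rewrite -(tfun_ltE g) !tinvK. Qed.

Lemma tinv_leE g x y : (tinv g x <= tinv g y) = (x <= y).
Proof. by rewrite -(tfun_leE g) !tinvK. Qed.

Lemma dyadicD x y : dyadic x -> dyadic y -> dyadic (x + y).
Proof.
move=> [a [n ->]] [b [m ->]]; exists (a * 2 ^+ m + b * 2 ^+ n), (n + m)%N.
rewrite exprD rmorphD !rmorphM !rmorphXn /=.
have p2 (k : nat) : (2 : R) ^+ k != 0 by rewrite expf_eq0 pnatr_eq0 andbF.
by field; rewrite !p2.
Qed.

Lemma dyadicN x : dyadic x -> dyadic (- x).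
Proof. by move=> [a [n ->]]; exists (- a), n; rewrite rmorphN mulNr. Qed.

Lemma dyadicM x y : dyadic x -> dyadic y -> dyadic (x * y).
Proof.
move=> [a [n ->]] [b [m ->]]; exists (a * b), (n + m)%N.
by rewrite exprD rmorphM invfM mulrACA.
Qed.

Lemma dyadic_int (a : int) : dyadic (a%:~R : R).
Proof. by exists a, 0%N; rewrite expr0 divr1. Qed.

Lemma dyadic0 : dyadic (0 : R). Proof. exact: (dyadic_int 0). Qed.

Lemma dyadicXz (k : int) : dyadic (2 ^ k : R).
Proof.
case: k => n; last by exists 1, n.+1; rewrite mul1r NegzE -exprnN.
by exists (2 ^+ n), 0%N; rewrite expr0 divr1 rmorphXn.
Qed.

Lemma tfun_dyadic g x : 0 < x < 1 -> dyadic x -> dyadic (g x).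
Proof.
have [B [Bd Bpl]] := tfun_pl g.
have [n] := ubnP (size [seq b <- B | 0 < b < x]).
elim: n x => // n IHn x /ltnSE-szx /andP[x0 x1] xd.
pose u := \big[Num.max/0]_(b <- B | 0 < b < x) b.
have uB : u = 0 \/ u \in B /\ 0 < u < x.
  rewrite /u big_seq_cond.
  apply: (big_ind (fun w : R => w = 0 \/ w \in B /\ 0 < w < x)) => [|v w|b].
  - by left.
  - by rewrite /Num.max; case: ifP.
  - by move=> /andP[]; right.
have uP b : b \in B -> 0 < b < x -> b <= u.
  by move=> bB bx; apply: le_bigmax_seq.
have ux : u < x by case: uB => [->|[_ /andP[]]].
have u0 : 0 <= u by case: uB => [->|[_ /andP[/ltW]]].
have gu : dyadic (g u).
  case: uB => [->|[uB /andP[u_gt0 _]]]; first by rewrite tfun0; exact: dyadic0.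
  apply: IHn; rewrite ?u_gt0 ?(lt_trans ux) //; last exact: Bd.
  apply: leq_trans szx; rewrite !size_filter.
  have -> : count (fun b => 0 < b < x) B =
      (count (fun b => (0%R < b)%R && (b < u)%R) B +
       count (fun b => (u <= b)%R && (b < x)%R) B)%N.
    rewrite -count_predUI [X in (_ + X)%N](_ : _ = 0%N) ?addn0; last first.
      apply/eqP; rewrite -leqn0 leqNgt -has_count; apply/hasPn => b _ /=.
      by case: (ltP b u) => //=; rewrite ?andbF.
    apply: eq_count => b /=; case: (ltP b u) => bu /=.
      by rewrite (lt_trans bu ux) ?andbT ?orbF.
    by rewrite andbF (lt_le_trans u_gt0 bu).
  rewrite -[X in (X < _)%N]addn0 ltn_add2l -has_count.
  by apply/hasP; exists u; rewrite // lexx.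
have [|b bB|k] := Bpl u x u0 ux; first exact: ltW.
- by apply/negP => /andP[ub bx]; have := uP b bB;
    rewrite bx (le_lt_trans u0 ub) leNgt ub => /(_ isT).
move=> /(_ x); rewrite lexx ltW //= => -> //.
apply: dyadicD => //; apply: dyadicM; first exact: dyadicXz.
apply: dyadicD => //; apply: dyadicN.
by case: uB => [->|[/Bd]//]; exact: dyadic0.
Qed.

Lemma tfun_dyadicT g x : dyadic x -> dyadic (g x).
Proof.
by case: (boolP (0 < x < 1)) => [/tfun_dyadic|/tfun_out->]; first exact.
Qed.

Fact id_pl : dyadic_pl (@id R).
Proof.
by exists [::]; split=> // u v _ _ _ _; exists 0 => x _; rewrite expr0z /=; ring.
Qed.

Definition thompson1 : thompson R :=
  @Thompson R id id (fun=> erefl) (fun=> erefl) (fun=> cvg_id) (fun=> cvg_id)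
    (fun _ _ => id) (fun _ _ => erefl) id_pl.

Fact tinv_pl g : dyadic_pl (tinv g).
Proof.
have [B [Bd Bpl]] := tfun_pl g; exists (map g B); split.
  by move=> _ /mapP[b bB ->]; exact/tfun_dyadicT/Bd.
move=> u v u0 uv v1 uvB.
have [|||b bB|k kP] := Bpl (tinv g u) (tinv g v).
- by rewrite -(tinv0 g) tinv_leE.
- by rewrite tinv_ltE.
- by rewrite -(tinv1 g) tinv_leE.
- apply: contra (uvB _ (map_f g bB)).
  by rewrite -(tfun_ltE g) -(tfun_ltE g b) !tinvK.
exists (- k) => x /andP[ux xv].
have k0 : 2 ^ k != 0 :> R by rewrite expfz_neq0 // pnatr_eq0.
have k_gt0 : 0 < 2 ^ k :> R by rewrite exprz_gt0.
have := kP (tinv g v); rewrite lexx tinv_leE (ltW uv) !tinvK => /(_ isT) ev.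
have := kP (tinv g x); rewrite !tinv_leE ux xv !tinvK => /(_ isT) ex.
by rewrite {2}ex -invr_expz; field.
Qed.

Definition thompsonV g : thompson R :=
  @Thompson R (tinv g) g (tinvK g) (tfunK g) (@tinv_continuous R g)
    (@tfun_continuous R g) (@tinv_lt g) (@tinv_out g) (tinv_pl g).

Fact comp_pl g h : dyadic_pl (g \o h).
Proof.
have [A [Ad Apl]] := tfun_pl g; have [B [Bd Bpl]] := tfun_pl h.
exists (B ++ map (tinv h) A); split.
  move=> b; rewrite mem_cat => /orP[/Bd //|/mapP[c cA ->]].
  exact/(@tfun_dyadicT (thompsonV h))/Ad.
move=> u v u0 uv v1 uvB.
have [//|//|//|b bB|k kP] := Bpl u v.
  by apply: uvB; rewrite mem_cat bB.
have [|||b bB|l lP] := Apl (h u) (h v).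
- by rewrite -(tfun0 h) tfun_leE.
- by rewrite tfun_ltE.
- by rewrite -(tfun1 h) tfun_leE.
- have := uvB (tinv h b); rewrite mem_cat map_f ?orbT // => /(_ isT).
  by rewrite -(tfun_ltE h) -(tfun_ltE h _ v) !tinvK.
exists (l + k) => x /[dup] /andP[ux xv] /kP hx /=.
rewrite lP ?tfun_leE ?ux ?xv // hx expfzDr ?pnatr_eq0 //; ring.
Qed.

Definition thompsonM g h : thompson R.
Proof.
refine (@Thompson R (g \o h) (tinv h \o tinv g) _ _ _ _ _ _ (comp_pl g h)).
- exact: can_comp (@tfunK R g) (@tfunK R h).
- exact: can_comp (@tinvK R h) (@tinvK R g).
- by move=> x; apply: continuous_comp; exact: tfun_continuous.
- by move=> x; apply: continuous_comp; exact: tinv_continuous.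
- by move=> x y /= xy; rewrite !tfun_ltE.
- by move=> x xo /=; rewrite (tfun_out h xo) tfun_out.
Defined.

Fact thompsonMA : associative thompsonM.
Proof. by move=> g h k; apply: thompsonP. Qed.
Fact thompsonM1 : right_id thompson1 thompsonM.
Proof. by move=> g; apply: thompsonP. Qed.
Fact thompson1M : left_id thompson1 thompsonM.
Proof. by move=> g; apply: thompsonP. Qed.
Fact thompsonVM : left_inverse thompson1 thompsonV thompsonM.
Proof. by move=> g; apply: thompsonP => x /=; rewrite tfunK. Qed.
Fact thompsonMV : right_inverse thompson1 thompsonV thompsonM.
Proof. by move=> g; apply: thompsonP => x /=; rewrite tinvK. Qed.

HB.instance Definition _ := isGroup.Build (thompson R)
  thompsonMA thompson1M thompsonM1 thompsonVM thompsonMV.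

Fact tact_subproof g (x : X R) : g (val x) \in X R.
Proof.
case: x => x /= /set_mem[/[dup] xI /andP[x0 x1] xd]; apply/mem_set; split.
  apply/andP; split; first by rewrite -(tfun0 g) tfun_ltE.
  by rewrite -(tfun1 g) tfun_ltE.
exact: tfun_dyadic.
Qed.

Definition tact g (x : X R) : X R := exist _ (g (val x)) (tact_subproof g x).

Lemma tact1 (x : X R) : tact 1%g x = x. Proof. exact: val_inj. Qed.
Lemma tactM g h (x : X R) : tact (g * h)%g x = tact g (tact h x).
Proof. exact: val_inj. Qed.

Definition a_fun x : R :=
  if x <= 0 then x
  else if x <= 1/4 then 2 * x
  else if x <= 3/4 then x / 2 + 3/8
  else x.

Definition a_inv x : R :=
  if x <= 0 then x
  else if x <= 1/2 then x / 2
  else if x <= 3/4 then 2 * x - 3/4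
  else x.

Definition b_fun x : R :=
  if x <= 1/2 then x
  else if x <= 3/4 then x / 2 + 1/4
  else if x <= 7/8 then x - 1/8
  else if x <= 1 then 2 * x - 1
  else x.

Definition b_inv x : R :=
  if x <= 1/2 then x
  else if x <= 5/8 then 2 * x - 1/2
  else if x <= 3/4 then x + 1/8
  else if x <= 1 then x / 2 + 1/2
  else x.

Lemma increasing_can_continuous (f f' : R -> R) :
  cancel f f' -> cancel f' f -> {homo f : x y / x < y} ->
  continuous f /\ continuous f'.
Proof.
have H (h h' : R -> R) : cancel h' h -> {mono h : x y / x < y} -> continuous h.
  move=> h'K hlt x; apply/cvgrPdist_lt => e e0; near=> y.
  rewrite distrC ltr_distl -[_ - e]h'K -[_ + e]h'K !hlt.
  by apply/andP; split; near: y; [apply: lt_nbhsr|apply: lt_nbhsl];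
    rewrite -hlt h'K; lra.
move=> fK f'K /le_mono/leW_mono flt; split; first exact: (H _ f').
by apply: (H _ f) => // x y; rewrite -flt !f'K.
Unshelve. all: by end_near. Qed.

Fact a_funK : cancel a_fun a_inv.
Proof.
move=> x; rewrite /a_fun; repeat (case: (lerP x) => ?);
  by rewrite /a_inv; repeat (case: lerP => ?); lra.
Qed.
Fact a_invK : cancel a_inv a_fun.
Proof.
move=> x; rewrite /a_inv; repeat (case: (lerP x) => ?);
  by rewrite /a_fun; repeat (case: lerP => ?); lra.
Qed.
Fact b_funK : cancel b_fun b_inv.
Proof.
move=> x; rewrite /b_fun; repeat (case: (lerP x) => ?);
  by rewrite /b_inv; repeat (case: lerP => ?); lra.
Qed.
Fact b_invK : cancel b_inv b_fun.
Proof.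
move=> x; rewrite /b_inv; repeat (case: (lerP x) => ?);
  by rewrite /b_fun; repeat (case: lerP => ?); lra.
Qed.

Fact a_lt : {homo a_fun : x y / x < y}.
Proof.
by move=> x y xy; rewrite /a_fun; repeat (case: (lerP x) => ?);
  repeat (case: (lerP y) => ?); lra.
Qed.
Fact b_lt : {homo b_fun : x y / x < y}.
Proof.
by move=> x y xy; rewrite /b_fun; repeat (case: (lerP x) => ?);
  repeat (case: (lerP y) => ?); lra.
Qed.
Fact a_out x : ~~ (0 < x < 1) -> a_fun x = x.
Proof.
rewrite negb_and -!leNgt => /orP xo; rewrite /a_fun.
by repeat (case: (lerP x) => ?); case: xo => xo; lra.
Qed.
Fact b_out x : ~~ (0 < x < 1) -> b_fun x = x.
Proof.
rewrite negb_and -!leNgt => /orP xo; rewrite /b_fun.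
by repeat (case: (lerP x) => ?); case: xo => xo; lra.
Qed.

Fact a_continuous : continuous a_fun.
Proof. exact: (increasing_can_continuous a_funK a_invK a_lt).1. Qed.
Fact a_inv_continuous : continuous a_inv.
Proof. exact: (increasing_can_continuous a_funK a_invK a_lt).2. Qed.
Fact b_continuous : continuous b_fun.
Proof. exact: (increasing_can_continuous b_funK b_invK b_lt).1. Qed.
Fact b_inv_continuous : continuous b_inv.
Proof. exact: (increasing_can_continuous b_funK b_invK b_lt).2. Qed.

Fact a_pl : dyadic_pl a_fun.
Proof.
have E1 x : 0 <= x <= 1/4 -> a_fun x = 2 * x.
  by move=> /andP[? ?]; rewrite /a_fun; repeat case: (lerP x) => ?; lra.
have E2 x : 1/4 <= x <= 3/4 -> a_fun x = x / 2 + 3/8.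
  by move=> /andP[? ?]; rewrite /a_fun; repeat case: (lerP x) => ?; lra.
have E3 x : 3/4 <= x -> a_fun x = x.
  by move=> ?; rewrite /a_fun; repeat case: (lerP x) => ?; lra.
exists [:: 1/4; 3/4]; split.
  move=> b; rewrite !inE => /orP[] /eqP->; [exists 1, 2%N|exists 3, 2%N];
    by rewrite -natrX.
move=> u v u0 uv v1 uvB.
have /nandP h1 := uvB (1/4) ltac:(by rewrite !inE eqxx).
have /nandP h2 := uvB (3/4) ltac:(by rewrite !inE eqxx orbT).
rewrite -!leNgt {uvB} in h1 h2; case: h1 => h1; last first.
  exists 1 => x /andP[ux xv]; rewrite !E1 ?u0 ?(le_trans u0 ux) /=; last 2 first.
  - lra.
  - lra.
  by rewrite expr1z; ring.
case: h2 => h2; last first.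
  exists (- 1) => x /andP[ux xv].
  rewrite !E2 ?h1 ?(le_trans h1 ux) /=; [|lra|lra].
  by rewrite -invr_expz expr1z; field.
exists 0 => x /andP[ux xv].
by rewrite !E3 ?(le_trans h2 ux) // expr0z; ring.
Qed.

Fact b_pl : dyadic_pl b_fun.
Proof.
have E0 x : x <= 1/2 -> b_fun x = x by rewrite /b_fun => ->.
have E1 x : 1/2 <= x <= 3/4 -> b_fun x = x / 2 + 1/4.
  by move=> /andP[? ?]; rewrite /b_fun; repeat case: (lerP x) => ?; lra.
have E2 x : 3/4 <= x <= 7/8 -> b_fun x = x - 1/8.
  by move=> /andP[? ?]; rewrite /b_fun; repeat case: (lerP x) => ?; lra.
have E3 x : 7/8 <= x <= 1 -> b_fun x = 2 * x - 1.
  by move=> /andP[? ?]; rewrite /b_fun; repeat case: (lerP x) => ?; lra.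
exists [:: 1/2; 3/4; 7/8]; split.
  move=> b; rewrite !inE => /or3P[] /eqP->;
    [exists 1, 1%N|exists 3, 2%N|exists 7, 3%N]; by rewrite -natrX.
move=> u v u0 uv v1 uvB.
have /nandP h1 := uvB (1/2) ltac:(by rewrite !inE eqxx).
have /nandP h2 := uvB (3/4) ltac:(by rewrite !inE eqxx orbT).
have /nandP h3 := uvB (7/8) ltac:(by rewrite !inE eqxx !orbT).
rewrite -!leNgt {uvB} in h1 h2 h3; case: h1 => h1; last first.
  exists 0 => x /andP[ux xv].
  rewrite !E0 ?(le_trans xv h1) //; last by rewrite (le_trans (ltW uv)).
  by rewrite expr0z; ring.
case: h2 => h2; last first.
  exists (- 1) => x /andP[ux xv].
  rewrite !E1 ?h1 ?(le_trans h1 ux) /=; [|lra|lra].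
  by rewrite -invr_expz expr1z; field.
case: h3 => h3; last first.
  exists 0 => x /andP[ux xv].
  rewrite !E2 ?h2 ?(le_trans h2 ux) /=; [|lra|lra].
  by rewrite expr0z; ring.
exists 1 => x /andP[ux xv].
rewrite !E3 ?h3 ?(le_trans h3 ux) /=; [|lra|lra].
by rewrite expr1z; ring.
Qed.

Definition thompson_a : thompson R :=
  Thompson a_funK a_invK a_continuous a_inv_continuous a_lt a_out a_pl.
Definition thompson_b : thompson R :=
  Thompson b_funK b_invK b_continuous b_inv_continuous b_lt b_out b_pl.

End ThompsonTheory.

Section Lamplighter.
Variable R : realType.
Implicit Types (A B C : {fset X R}) (g h : thompson R).
Local Open Scope fset_scope.

Definition fsymdiff A B : {fset X R} := (A `\` B) `|` (B `\` A).

Lemma in_fsymdiff A B x : (x \in fsymdiff A B) = (x \in A) (+) (x \in B).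
Proof. by rewrite !inE; case: (x \in A); case: (x \in B). Qed.

Lemma fsymdiffA : associative fsymdiff.
Proof. by move=> A B C; apply/fsetP => x; rewrite !in_fsymdiff addbA. Qed.

Lemma fsymdiff0l : left_id fset0 fsymdiff.
Proof. by move=> A; apply/fsetP => x; rewrite in_fsymdiff inE. Qed.

Lemma fsymdiff0r : right_id fset0 fsymdiff.
Proof. by move=> A; apply/fsetP => x; rewrite in_fsymdiff inE addbF. Qed.

Lemma fsymdiffxx A : fsymdiff A A = fset0.
Proof. by apply/fsetP => x; rewrite in_fsymdiff inE addbb. Qed.

Definition fset_act g A : {fset X R} := [fset tact g x | x in A].

Lemma in_fset_act g A x : (x \in fset_act g A) = (tact g^-1%g x \in A).
Proof.
apply/imfsetP/idP => /= [[y yA ->]|xA]; first by rewrite -tactM mulVg tact1.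
by exists (tact g^-1%g x); rewrite // -tactM mulgV tact1.
Qed.

Lemma fset_act1 A : fset_act 1%g A = A.
Proof. by apply/fsetP => x; rewrite in_fset_act invg1 tact1. Qed.

Lemma fset_actM g h A : fset_act (g * h)%g A = fset_act g (fset_act h A).
Proof. by apply/fsetP => x; rewrite !in_fset_act invgM tactM. Qed.

Lemma fset_actD g A B :
  fset_act g (fsymdiff A B) = fsymdiff (fset_act g A) (fset_act g B).
Proof. by apply/fsetP => x; rewrite !(in_fset_act, in_fsymdiff). Qed.

Lemma fset_act0 g : fset_act g fset0 = fset0.
Proof. by apply/fsetP => x; rewrite in_fset_act !inE. Qed.

Record lamplighter := Lamplighter {
  lamps : {fset X R};
  walker : thompson R }.

HB.instance Definition _ := gen_eqMixin lamplighter.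
HB.instance Definition _ := gen_choiceMixin lamplighter.

Definition lamp_one := Lamplighter fset0 1%g.
Definition lamp_mul s t :=
  Lamplighter (fsymdiff (lamps s) (fset_act (walker s) (lamps t)))
              (walker s * walker t)%g.
Definition lamp_inv s :=
  Lamplighter (fset_act (walker s)^-1%g (lamps s)) (walker s)^-1%g.

Fact lamp_mulA : associative lamp_mul.
Proof.
move=> [A g] [B h] [C k]; rewrite /lamp_mul /=.
by rewrite mulgA fset_actM fset_actD fsymdiffA.
Qed.
Fact lamp_mul1 : right_id lamp_one lamp_mul.
Proof.
by move=> [A g]; rewrite /lamp_mul /= fset_act0 fsymdiff0r mulg1.
Qed.
Fact lamp_1mul : left_id lamp_one lamp_mul.
Proof. by move=> [A g]; rewrite /lamp_mul /= fset_act1 fsymdiff0l mul1g. Qed.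
Fact lamp_Vmul : left_inverse lamp_one lamp_inv lamp_mul.
Proof. by move=> [A g]; rewrite /lamp_mul /= fsymdiffxx mulVg. Qed.
Fact lamp_mulV : right_inverse lamp_one lamp_inv lamp_mul.
Proof.
move=> [A g].
by rewrite /lamp_mul /= -fset_actM mulgV fset_act1 fsymdiffxx.
Qed.

HB.instance Definition _ := isGroup.Build lamplighter
  lamp_mulA lamp_1mul lamp_mul1 lamp_Vmul lamp_mulV.

Definition lamp_act (s : lamplighter) A : {fset X R} :=
  fsymdiff (lamps s) (fset_act (walker s) A).

Lemma lamp_act1 A : lamp_act 1%g A = A.
Proof. by rewrite /lamp_act /= fset_act1 fsymdiff0l. Qed.

Lemma lamp_actM (s t : lamplighter) A :
  lamp_act (s * t)%g A = lamp_act s (lamp_act t A).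
Proof. by rewrite /lamp_act /= fset_actM fset_actD fsymdiffA. Qed.

End Lamplighter.

Section MinFunctions.
Variable R : realType.

Fact base_point_subproof : 5 / 8 \in X R.
Proof.
apply/mem_set; split; first by apply/andP; split; lra.
by exists 5, 3%N; congr (_ / _); rewrite -natrX.
Qed.

Definition base_point : X R := exist _ (5 / 8) base_point_subproof.

Definition superharmonic (phi : X R -> R) : Prop :=
  forall x, phi x >=
    (phi (tact (thompson_a R) x) + phi (tact (thompson_b R) x) +
     phi (tact (thompson_a R)^-1%g x) + phi (tact (thompson_b R)^-1%g x)) / 4.

Definition cube m : set 'rV[R]_m := [set x | forall i, 0 < x 0 i <= 1].
Arguments cube m : clear implicits.

Definition symmetric_on_cube m (r : 'rV[R]_m -> R) : Prop :=
  forall (s : 'S_m) (x : 'rV[R]_m), cube m x -> r (col_perm s x) = r x.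

Definition concave_on_cube m (r : 'rV[R]_m -> R) : Prop :=
  forall (x y : 'rV[R]_m) (t : R), cube m x -> cube m y -> 0 <= t <= 1 ->
    t * r x + (1 - t) * r y <= r (t *: x + (1 - t) *: y).

Definition nondecreasing_on_cube m (r : 'rV[R]_m -> R) : Prop :=
  forall (i : 'I_m) (x y : 'rV[R]_m), cube m x -> cube m y ->
    (forall j, j != i -> x 0 j = y 0 j) -> x 0 i <= y 0 i -> r x <= r y.

Definition seqT : set (nat -> R) :=
  [set x | (forall i, 0 < x i <= 1) /\ finite_set [set i | x i != 1]].

(* For [x] in [seqT] this lists the finitely many coordinates different from 1 in
   non-decreasing order, with multiplicity, followed by infinitely many 1s; see
   [rearrangement_nd] and [rearrangement_bij]. *)
Definition rearrangement (x : nat -> R) : nat -> R :=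
  nth 1 (sort <=%R [seq x i | i <- fset_set [set i | x i != 1]]).

Lemma rearrangement_prefix (x : nat -> R) : seqT x -> exists N,
  (forall i, (N <= i)%N -> x i = 1) /\
  rearrangement x =1 nth 1 (sort <=%R [seq x i | i <- iota 0 N]).
Proof.
move=> [x01 xfin].
pose S := fset_set [set i | x i != 1].
have S_in i : (i \in S) = (x i != 1).
  by rewrite in_fset_set //; apply/idP/idP => [/set_mem//|/mem_set].
pose N := (\max_(i <- S) i).+1; exists N.
have xN i : (N <= i)%N -> x i = 1.
  move=> Ni; apply/eqP/negPn; rewrite -S_in; apply: contraTN Ni => iS.
  by rewrite -ltnNge ltnS (@bigop.leq_bigmax_seq _ (enum_fset S) xpredT id i).
split=> //; suff -> : sort <=%R [seq x i | i <- iota 0 N] =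
    sort <=%R [seq x i | i <- S] ++
    nseq (count (fun i => x i == 1) (iota 0 N)) 1.
  move=> i; rewrite nth_cat /rearrangement -/S; case: ltnP => // iS.
  by rewrite nth_default // nth_nseq if_same.
apply: le_sorted_eq; first exact: sort_le_sorted.
  rewrite (sorted_pairwise le_trans) pairwise_cat; apply/and3P; split.
  - apply/allrelP => y z; rewrite mem_sort => /mapP[i _ ->].
    by rewrite mem_nseq => /andP[_ /eqP->]; case/andP: (x01 i).
  - by rewrite -(sorted_pairwise le_trans) sort_le_sorted.
  - rewrite -(sorted_pairwise le_trans).
    by elim: count => // -[|k] //= ->; rewrite lexx.
rewrite perm_sort.
have -> : nseq (count (fun i => x i == 1) (iota 0 N)) 1 =
    [seq x i | i <- iota 0 N & predC (fun i => x i != 1) i].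
  elim: (iota 0 N) => //= i l IHl; rewrite negbK.
  by case: eqP => [xi1|_] /=; rewrite ?xi1 IHl.
rewrite perm_sym (perm_trans (_ : perm_eq _
    ([seq x i | i <- iota 0 N & x i != 1] ++
     [seq x i | i <- iota 0 N & predC (fun i => x i != 1) i]))) //; last first.
  by rewrite -map_cat perm_map // perm_filterC.
rewrite perm_cat2r perm_sort perm_map //; apply: uniq_perm.
- exact: fset_uniq.
- by rewrite filter_uniq // iota_uniq.
move=> i; rewrite S_in mem_filter mem_iota add0n /=.
by case: ltnP => [|/xN ->]; rewrite ?andbT ?eqxx.
Qed.

Lemma rearrangement_nd (x : nat -> R) : seqT x ->
  {homo rearrangement x : i j / (i <= j)%N >-> i <= j}.
Proof.
move=> [x01 xfin] i j ij; rewrite /rearrangement; set s := sort _ _.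
have [js|sj] := ltnP j (size s); last first.
  rewrite (nth_default _ sj); have [si|si] := ltnP i (size s); last first.
    by rewrite nth_default.
  have := mem_nth 1 si; rewrite mem_sort => /mapP[k _ ->].
  by case/andP: (x01 k).
apply: (sorted_leq_nth le_trans lexx 1 (sort_le_sorted _)) => //.
by rewrite inE (leq_ltn_trans ij).
Qed.

Lemma rearrangement_bij (x : nat -> R) : seqT x ->
  exists2 s : nat -> nat, bijective s & rearrangement x =1 x \o s.
Proof.
move=> /rearrangement_prefix[N [xN xE]].
set l := [seq x i | i <- iota 0 N] in xE.
have : perm_eq (sort <=%R l) l by rewrite perm_sort.
move=> /(perm_iotaP 1).
rewrite size_map size_iota => -[Is Isp Ise].
have szI : size Is = N by rewrite (perm_size Isp) size_iota.
have uI : uniq Is by rewrite (perm_uniq Isp) iota_uniq.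
have mI i : (i \in Is) = (i < N)%N by rewrite (perm_mem Isp) mem_iota.
exists (fun i => if (i < N)%N then nth 0 Is i else i).
  exists (fun i => if (i < N)%N then index i Is else i) => i.
    case: (ltnP i N) => iN; last by rewrite ltnNge iN.
    by rewrite -mI mem_nth ?szI // index_uniq ?szI.
  case: (ltnP i N) => iN; last by rewrite ltnNge iN.
  by rewrite -{1}szI index_mem mI iN nth_index ?mI.
move=> i /=; rewrite xE Ise; case: (ltnP i N) => iN.
  rewrite (nth_map 0%N) ?szI // (nth_map 0%N) ?size_iota -?mI ?mem_nth ?szI //.
  by rewrite nth_iota -?mI ?mem_nth ?szI.
by rewrite nth_default ?size_map ?szI // xN.
Qed.

Definition min_fun m (r : 'rV[R]_m -> R) (x : nat -> R) : R :=
  r (\row_(k < m) rearrangement x k).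

Definition pad_values (phi : X R -> R) (E : {fset X R}) : nat -> R :=
  nth 1 [seq phi q | q <- enum_fset E].

Lemma pad_values_T phi E : (forall q, 0 < phi q <= 1) -> seqT (pad_values phi E).
Proof.
move=> phi01; split=> [i|].
  rewrite /pad_values; case: (ltnP i (size (map phi (enum_fset E)))) => iE.
    by have /mapP[q _ ->] := mem_nth 1 iE.
  by rewrite nth_default // ltr01 lexx.
apply: (sub_finite_set _ (finite_II (size (map phi (enum_fset E))))) => i /=.
by apply: contra_neqT; rewrite -leqNgt => /(nth_default 1).
Qed.

Definition generalized_min_function (f : {fset X R} -> R) : Prop :=
  exists (m : nat) (r : 'rV[R]_m -> R) (phi : X R -> R),
    [/\ (0 < m)%N,
        [/\ forall x, cube m x -> 0 < r x,
            symmetric_on_cube r,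
            concave_on_cube r &
            nondecreasing_on_cube r],
        [/\ forall q, 0 < phi q <= 1,
            superharmonic phi &
            phi base_point = 1] &
        forall E, f E = min_fun r (pad_values phi E)].

End MinFunctions.

(* Main.v *)
(* Let c = inf phi. On (0, 1/2] the map b is trivial and a^-1 is halving, so
   superharmonicity makes k |-> phi (y / 2 ^ k) a concave sequence; being
   bounded below it is non-decreasing, and its ratios satisfy
   phi (y / 2 ^ (k + l)) <= (k + l) / k * phi (y / 2 ^ k). Points y_n <= 1/2
   where phi - c is at most (n + 1) ^ -2, also at y_n / 2, therefore have
   phi (y_n / 2 ^ n) -> c while phi (y_n / 2 ^ (n + i)) / phi (y_n / 2 ^ n) -> 1
   for bounded i, even for negative i. Take
   E_n = {y_n / 2 ^ (n + i) | i < m}. An element of F is multiplication by a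
   power of 2 near 0, so it only shifts i boundedly, and a finite set A of lamps
   is eventually disjoint from these points and cannot carry smaller values of
   phi in the limit: the m smallest values on s E_n are all asymptotic to
   phi (y_n / 2 ^ n). Finally, concavity, monotonicity and positivity give
   r x <= t * r y whenever x <= t * y with t >= 1. *)
Require Import Defs.
From mathcomp Require Import all_boot all_order all_algebra.
From mathcomp Require Import finmap.
From mathcomp Require Import all_classical all_reals all_analysis.
From mathcomp Require Import lra ring zify.
Import numFieldNormedType.Exports.
Import Order.TTheory GRing.Theory Num.Theory.
Set Implicit Arguments.
Unset Strict Implicit.
Unset Printing Implicit Defensive.

Local Open Scope classical_set_scope.
Local Open Scope ring_scope.

(** * Bounds for finite sets and powers of 2 *)

Lemma pos_seq_lbound (R : realType) (s : seq R) :
  (forall x, x \in s -> 0 < x) ->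
  exists2 d : R, 0 < d & forall x, x \in s -> d <= x.
Proof.
elim: s => [|a s IHs] sP; first by exists 1.
have [x xs|d d0 dP] := IHs; first by apply: sP; rewrite inE xs orbT.
exists (Num.min a d); first by rewrite lt_min d0 sP // mem_head.
move=> x; rewrite inE => /predU1P[->|/dP dx]; first by rewrite ge_min lexx.
by rewrite ge_min dx orbT.
Qed.

Lemma natr_ubound (R : realType) (x : R) :
  exists N : nat, forall n, (N <= n)%N -> x < n%:R.
Proof.
exists (Num.truncn x).+1 => n nN.
by apply: lt_le_trans (truncnS_gt x) _; rewrite ler_nat.
Qed.

Lemma pow2_small (R : realType) (d : R) : 0 < d ->
  exists N : nat, forall n, (N <= n)%N -> (2 ^+ n)^-1 < d.
Proof.
move=> d0; have [N NP] := natr_ubound d^-1; exists N => n /NP nd.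
rewrite invf_plt ?posrE ?exprn_gt0 //; apply: lt_trans nd _.
by rewrite -natrX ltr_nat ltn_expl.
Qed.

(** * Concave sequences bounded below *)

Section ConcaveSequence.
Variables (R : realType) (f : nat -> R).
Hypothesis f_concave : forall k, f k + f k.+2 <= 2 * f k.+1.

Lemma concave_seq_tangent k l : f (k + l)%N <= f k + l%:R * (f k.+1 - f k).
Proof.
have step i : f (k + i).+1 - f (k + i)%N <= f k.+1 - f k.
  elim: i => [|i IHi]; first by rewrite addn0.
  by rewrite addnS; have := f_concave (k + i); lra.
elim: l => [|l IHl]; first by rewrite addn0 mul0r addr0.
by rewrite addnS -natr1; have := step l; lra.
Qed.

Hypothesis f_ge0 : forall k, 0 <= f k.

(** A negative increment would persist by concavity and push [f] below 0. *)
Lemma concave_seq_nd : {homo f : i j / (i <= j)%N >-> i <= j}.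
Proof.
apply: homo_leq => [//|x y z|k]; first exact: le_trans.
rewrite leNgt; apply/negP => fk.
have [N /(_ N (leqnn N))] := natr_ubound (f k / (f k - f k.+1)).
rewrite ltr_pdivrMr; last lra.
by have := concave_seq_tangent k N; have := f_ge0 (k + N); lra.
Qed.

Lemma concave_seq_ratio k l : k%:R * f (k + l)%N <= (k + l)%:R * f k.
Proof.
(* The line through the values at [k] and [k.+1], continued back to 0, stays nonnegative there. *)
have : k%:R * (f k.+1 - f k) <= f k.
  elim: k => [|k IHk]; first by rewrite mul0r.
  rewrite -natr1; have := f_concave k.
  have k0 : 0 <= k%:R :> R by [].
  nra.
have := concave_seq_tangent k l; rewrite natrD.
have k0 : 0 <= k%:R :> R by [].
have l0 : 0 <= l%:R :> R by [].
nra.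
Qed.

End ConcaveSequence.

(** * Superharmonic functions near the two ends of the interval *)

Section Superharmonic.
Variables (R : realType) (phi : X R -> R).
Hypotheses (phi_ge0 : forall x, 0 <= phi x) (phi_sh : superharmonic phi).

Let a := thompson_a R.
Let b := thompson_b R.

Lemma X_bounds (x : X R) : 0 < val x < 1.
Proof. by have /set_mem[] := valP x. Qed.

Lemma superharmonic_left (x : X R) : val x <= 1/2 ->
  phi (tact a x) + phi (tact a^-1%g x) <= 2 * phi x.
Proof.
move=> x2; have := phi_sh x; rewrite -/a -/b.
have -> : tact b x = x by apply: val_inj; rewrite /= /b_fun x2.
have -> : tact b^-1%g x = x by apply: val_inj; rewrite /= /b_inv x2.
lra.
Qed.

Lemma superharmonic_right (x : X R) : 3/4 <= val x ->
  phi (tact b x) + phi (tact b^-1%g x) <= 2 * phi x.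
Proof.
move=> x2; have := phi_sh x; rewrite -/a -/b.
have -> : tact a x = x.
  apply: val_inj; rewrite -[LHS]/(a_fun (val x)) /a_fun.
  by repeat (case: lerP => ?); lra.
have -> : tact a^-1%g x = x.
  apply: val_inj; rewrite -[LHS]/(a_inv (val x)) /a_inv.
  by repeat (case: lerP => ?); lra.
lra.
Qed.

Definition ray (y : X R) (k : nat) : X R := iter k (tact a^-1%g) y.

Lemma val_ray y k : val y <= 1/2 -> val (ray y k) = val y / 2 ^+ k.
Proof.
move=> y2; elim: k => [|k IHk]; first by rewrite divr1.
have /andP[y0 _] := X_bounds y.
have k1 : (2 ^+ k)^-1 <= 1 :> R by rewrite invf_le1 ?exprn_ege1 ?exprn_gt0 ?ler1n.
have k0 : 0 < (2 ^+ k)^-1 :> R by rewrite invr_gt0 exprn_gt0.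
rewrite -[LHS]/(a_inv (val (ray y k))) IHk exprSr invfM mulrA /a_inv.
have yk : 0 < val y / 2 ^+ k <= 1/2 by apply/andP; split; nra.
by case/andP: yk => yk0 yk2; rewrite leNgt yk0 yk2 /=; ring.
Qed.

Lemma ray_le y k : val y <= 1/2 -> val (ray y k) <= (2 ^+ k)^-1.
Proof.
move=> y2; rewrite val_ray // ler_piMl ?invr_ge0 ?exprn_ge0 //; lra.
Qed.

Lemma ray_inj y : val y <= 1/2 -> injective (ray y).
Proof.
move=> y2 i j /(congr1 val); rewrite !val_ray //.
have /andP[y0 _] := X_bounds y.
by move=> /(mulfI (lt0r_neq0 y0))/invr_inj/ieexprIn; apply; rewrite ?pnatr_eq1.
Qed.

Lemma ray_concave y k : val y <= 1/2 ->
  phi (ray y k) + phi (ray y k.+2) <= 2 * phi (ray y k.+1).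
Proof.
move=> y2.
have <- : tact a (ray y k.+1) = ray y k by rewrite /= -tactM mulgV tact1.
apply: superharmonic_left; rewrite val_ray //.
apply: le_trans y2; have /andP[y0 _] := X_bounds y.
by rewrite ler_piMr ?(ltW y0) // invf_le1 ?exprn_ege1 ?exprn_gt0 ?ler1n.
Qed.

(* Near 1 the map a is trivial, so phi is concave along the orbits of b there. *)
Lemma superharmonic_b_le (x : X R) : 3/4 <= val x -> phi (tact b x) <= phi x.
Proof.
(* Index 0 is [b x], index 1 is [x]. All terms from index 1 on lie in [3/4, 1), and concavity needs
   only the middle term there. *)
move=> x34; pose f k := phi (iter k (tact b^-1%g) (tact b x)).
have binv y : tact b^-1%g (tact b y) = y by rewrite -tactM mulVg tact1.
have -> : phi x = f 1%N by rewrite /f /= binv.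
have x34k k : 3/4 <= val (iter k.+1 (tact b^-1%g) (tact b x)).
  elim: k => [|k IHk]; first by rewrite -[iter 1 _ _]/(tact b^-1%g (tact b x)) binv.
  rewrite [iter k.+2 _ _]iterS; move: (iter k.+1 _ _) IHk => z z34.
  have /andP[_ z1] := X_bounds z.
  rewrite -[val (tact _ z)]/(b_inv (val z)) /b_inv.
  by repeat (case: (lerP (val z)) => ?); lra.
apply: (@concave_seq_nd _ f _ _ 0%N 1%N) => // k; last exact: phi_ge0.
have /superharmonic_right := x34k k.
by rewrite {1}iterS -tactM mulgV tact1.
Qed.

(** Above 7/8 the map [b] doubles the distance to 1, and between 3/4 and 7/8 it subtracts 1/8, so
    finitely many steps lead below 3/4; [phi] never increases on the way. *)
Lemma superharmonic_descent (x : X R) :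
  exists2 y : X R, val y <= 3/4 & phi y <= phi x.
Proof.
have /andP[_ x1] := X_bounds x.
have [N /(_ N (leqnn N))] : exists N : nat, forall n, (N <= n)%N ->
    (2 ^+ n)^-1 < 1 - val x by apply: pow2_small; lra.
elim: N x {x1} => [|N IHN] x xN.
  by have := X_bounds x; rewrite expr0 invr1 in xN; lra.
have [x34|x34] := lerP (val x) (3/4); first by exists x.
have bx := superharmonic_b_le (ltW x34).
have [x78|x78] := lerP (val x) (7/8).
  exists (tact b x) => //; rewrite -[val _]/(b_fun (val x)) /b_fun.
  by repeat (case: (lerP (val x)) => ?); lra.
have [|y y34 yx] := IHN (tact b x); last by exists y; rewrite ?(le_trans yx).
have /andP[_ x1] := X_bounds x.
have -> : val (tact b x) = 2 * val x - 1.
  by rewrite -[LHS]/(b_fun (val x)) /b_fun; repeat (case: lerP => ?); lra.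
move: xN; rewrite exprS invfM; lra.
Qed.

(** [phi - c] is nonnegative and superharmonic, so each of the four neighbours carries at most the
    whole sum. *)
Lemma superharmonic_harnack c (x : X R) : (forall y, c <= phi y) ->
  phi (tact b x) - c <= 4 * (phi x - c) /\
  phi (tact a^-1%g x) - c <= 4 * (phi x - c).
Proof.
move=> cphi; have := phi_sh x; rewrite -/a -/b.
have := cphi (tact a x); have := cphi (tact b x).
have := cphi (tact a^-1%g x); have := cphi (tact b^-1%g x).
by move=> *; split; lra.
Qed.

Lemma ray_start c d : (forall y, c <= phi y) -> 0 < d ->
  (forall e, 0 < e -> exists x, phi x < c + e) ->
  exists y : X R, [/\ val y <= 1/2, phi (ray y 0) <= c + d &
                     phi (ray y 1) <= c + d].
Proof.
move=> cphi d0 /(_ (d / 256)) []; first lra.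
(* From [x <= 3/4], [b] leads below 5/8 and [a^-1] then below 1/2; a second [a^-1] gives the next
   ray point. These three steps cost a factor 64, which 256 covers. *)
move=> x0 x0d; have [x x34 xx0] := superharmonic_descent x0.
have [h1 _] := superharmonic_harnack x cphi.
have [_ h2] := superharmonic_harnack (tact b x) cphi.
have [_ h3] := superharmonic_harnack (tact a^-1%g (tact b x)) cphi.
exists (tact a^-1%g (tact b x)); split; last 2 first.
- by rewrite -[ray _ 0]/(tact a^-1%g (tact b x)); have := cphi x; lra.
- by rewrite -[ray _ 1]/(tact a^-1%g (tact a^-1%g (tact b x))); lra.
rewrite -[val _]/(a_inv (b_fun (val x))).
have bx : b_fun (val x) <= 5/8.
  by rewrite /b_fun; repeat (case: (lerP (val x)) => ?); lra.
by rewrite /a_inv; repeat (case: (lerP (b_fun _)) => ?); lra.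
Qed.

End Superharmonic.

(** * Elements of Thompson's group near 0 *)

Lemma thompson_near0 (R : realType) (g : thompson R) :
  exists (k : int) (d : R), 0 < d /\ forall x, 0 <= x <= d -> g x = 2 ^ k * x.
Proof.
have [B [_ Bpl]] := tfun_pl g.
(* No breakpoint lies strictly between 0 and [d]; the entry 1 keeps [d] inside the unit interval. *)
have [|d d0 dP] := @pos_seq_lbound R (1 :: [seq x <- B | 0 < x]).
  by move=> x; rewrite inE mem_filter => /predU1P[->|/andP[]].
have [//|//||bb bB|k kP] := Bpl 0 d.
- by apply: dP; rewrite mem_head.
- apply/negP => /andP[b0 bd].
  by have := dP bb; rewrite inE mem_filter b0 bB orbT leNgt bd => /(_ isT).
by exists k, d; split=> // x /kP; rewrite tfun0 add0r subr0.
Qed.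

Lemma thompson_ray (R : realType) (g : thompson R) :
  exists J N : nat, forall (y : X R) j, val y <= 1/2 -> (N <= j)%N ->
  exists j', [/\ tact g (ray y j) = ray y j', (j <= j' + J)%N &
                 (j' <= j + J)%N].
Proof.
have [k [d [d0 dP]]] := thompson_near0 g.
have [N NP] := pow2_small d0.
exists `|k|%N, (N + `|k|)%N => y j y2 jN.
have yj : 0 <= val (ray y j) <= d.
  have /andP[/ltW -> _] := X_bounds (ray y j).
  by apply: le_trans (ray_le j y2) _; apply/ltW/NP; lia.
have := dP _ yj; rewrite [in RHS]val_ray // => gj.
case: k gj jN {dP} => k gj jN.
  (* Slope [2 ^ k] lowers the index by [k]; the bound on [j] keeps this subtraction from
     truncating. *)
  exists (j - k)%N; split; [|lia|lia].
  apply: val_inj; rewrite val_ray // -[LHS]/(g (val (ray y j))) gj.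
  have -> : j = (k + (j - k))%N by lia.
  rewrite addKn exprD -exprnP; field.
  by rewrite !expf_neq0.
exists (j + k.+1)%N; split; [|lia|lia].
apply: val_inj; rewrite val_ray // -[LHS]/(g (val (ray y j))) gj.
by rewrite NegzE exprD -exprnN; field; rewrite !expf_neq0.
Qed.

(** * Monotone concave functions on the cube and the smallest values *)

Section ConcaveOnCube.
Variables (R : realType) (m : nat) (r : 'rV[R]_m -> R).
Hypothesis r_gt0 : forall x, cube x -> 0 < r x.
Hypothesis r_concave : concave_on_cube r.
Hypothesis r_nd : nondecreasing_on_cube r.

Lemma cube_mono (x y : 'rV[R]_m) : cube x -> cube y ->
  (forall i, x 0 i <= y 0 i) -> r x <= r y.
Proof.
move=> xC yC xy.
(* Passes from [x] to [y] one coordinate at a time. *)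
pose w k : 'rV[R]_m := \row_i (if (i < k)%N then y 0 i else x 0 i).
have wC k : cube (w k) by move=> i; rewrite mxE; case: ifP.
have -> : x = w 0%N by apply/rowP => i; rewrite mxE.
have -> : y = w m by apply/rowP => i; rewrite mxE ltn_ord.
have : (m <= m)%N by []; move: {1 3}m => k.
elim: k => // k IHk km; apply: le_trans (IHk (ltnW km)) _.
apply: (@r_nd (Ordinal km)) => //= [j jk|]; rewrite !mxE /= ?ltnn ?ltnSn //.
by rewrite ltnS [in RHS]leq_eqVlt; move: jk; rewrite -val_eqE /= => /negPf->.
Qed.

(** The origin is outside the cube, so [l *: x] is instead written as a convex combination of [x],
    with weight [u < l], and a smaller positive multiple of [x]. Positivity of [r] there gives
    [u * r x < r (l *: x)] for all such [u]. *)
Lemma cube_scale (l : R) (x : 'rV[R]_m) : cube x -> 0 < l <= 1 ->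
  l * r x <= r (l *: x).
Proof.
move=> xC /andP[l0]; rewrite le_eqVlt => /predU1P[->|l1].
  by rewrite scale1r mul1r.
have rx := r_gt0 xC.
rewrite leNgt; apply/negP => rl.
have [u ul ur] : exists2 u, 0 <= u < l & r (l *: x) < u * r x.
  exists (Num.max 0 ((r (l *: x) / r x + l) / 2)).
    rewrite le_max lexx gt_max l0 /=.
    by move: rl; rewrite -ltr_pdivrMr //; lra.
  have : r (l *: x) / r x < l by rewrite ltr_pdivrMr.
  rewrite -ltr_pdivrMr // lt_max => ?; apply/orP; right; lra.
have u1 : 0 < 1 - u by lra.
have zC : cube (((l - u) / (1 - u)) *: x).
  have c1 : 0 < (l - u) / (1 - u) <= 1.
    by rewrite divr_gt0 ?ler_pdivrMr; lra.
  by move=> i; have := xC i; rewrite mxE; nra.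
have := @r_concave x _ u xC zC; rewrite (_ : _ + _ = l *: x); last first.
  by rewrite scalerA -scalerDl; congr (_ *: _); field; lra.
by have := r_gt0 zC; nra.
Qed.

Lemma cube_le (t : R) (x y : 'rV[R]_m) : cube x -> cube y -> 1 <= t ->
  (forall i, x 0 i <= t * y 0 i) -> r x <= t * r y.
Proof.
move=> xC yC t1 xy; have t0 : 0 < t by lra.
have ti : 0 < t^-1 <= 1 by rewrite invr_gt0 t0 invf_le1.
rewrite -ler_pdivrMl //; apply: le_trans (cube_scale xC ti) _.
apply: cube_mono => // i; rewrite mxE; first by have := xC i; nra.
by rewrite ler_pdivrMl.
Qed.

End ConcaveOnCube.

(** If the value at position [k] exceeded [hi], all [m] points [e i] would occupy distinct sorted
    positions below [k < m]. The condition [lo <= 1] takes care of the padding. *)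
Lemma rearrangement_bounds (R : realType) (phi : X R -> R) (E : {fset X R})
    (m : nat) (e : 'I_m -> X R) (lo hi : R) :
  (forall q, 0 < phi q <= 1) -> lo <= 1 ->
  (forall q, q \in E -> lo <= phi q) ->
  injective e -> (forall i, e i \in E /\ phi (e i) <= hi) ->
  forall k, (k < m)%N -> lo <= rearrangement (pad_values phi E) k <= hi.
Proof.
move=> phi01 lo1 loE e_inj eE k km.
have xT := pad_values_T E phi01; set x := pad_values phi E in xT *.
have [s [s' s'K sK] xs] := rearrangement_bij xT.
apply/andP; split.
  rewrite xs /= /x /pad_values; set l := map _ _.
  have [iE|iE] := ltnP (s k) (size l); last by rewrite nth_default.
  by have /mapP[q qE ->] := mem_nth 1 iE; exact: loE.
rewrite leNgt; apply/negP => hik.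
(* The position of [e i] after sorting. *)
pose j i := s' (index (e i) (enum_fset E)).
have jk i : (j i < k)%N.
  rewrite ltnNge; apply/negP => /(rearrangement_nd xT) /(lt_le_trans hik).
  rewrite xs /= /j sK /x /pad_values.
  have [eiE eihi] := eE i.
  by rewrite (nth_map (e i)) ?index_mem // nth_index // ltNge eihi.
have /leq_card : injective (fun i => Ordinal (jk i)).
  move=> i i' /(congr1 val) /= /(can_inj sK).
  move=> /(congr1 (nth (e i) (enum_fset E))).
  have [eiE _] := eE i; have [ei'E _] := eE i'.
  by rewrite !nth_index // => /e_inj.
by rewrite !card_ord leqNgt km.
Qed.

(** * Translates of rays and the choice of base points *)

Section RayTranslates.
Variables (R : realType) (phi : X R -> R).
Hypotheses (phi_ge0 : forall x, 0 <= phi x) (phi_sh : superharmonic phi).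

Lemma ray_translate (g : thompson R) (m : nat) (t : R) : 1 < t ->
  exists N : nat, forall (n : nat) (y : X R) (i : nat),
    (N <= n)%N -> val y <= 1/2 -> (i < m)%N ->
    phi (ray y n) <= t * phi (tact g (ray y (n + i))) /\
    phi (tact g (ray y (n + i))) <= t * phi (ray y n).
Proof.
move=> t1; have [J [N gP]] := thompson_ray g.
(* Beyond this threshold both [n <= t * (n - J)] and [n + m + J <= t * n], the ratios needed for
   shifts down by [J] and up by [m + J]. *)
have [M MP] := natr_ubound ((t * (m + J)%:R) / (t - 1)).
exists (N + M + J).+1 => n y i nN y2 im.
have /MP : (M <= n)%N by lia.
rewrite ltr_pdivrMr ?subr_gt0 // => nt.
have [|j' [-> jj' j'j]] := gP y (n + i)%N y2; first lia.
have yconc k := ray_concave phi_sh k y2.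
pose f k := phi (ray y k).
have f_nd := concave_seq_nd yconc (fun k => phi_ge0 (ray y k)).
have f_ratio := concave_seq_ratio yconc (fun k => phi_ge0 (ray y k)).
have n0 : 0 < n%:R :> R by rewrite ltr0n; lia.
have m0 : 0 <= m%:R :> R by [].
have J0 : 0 <= J%:R :> R by [].
have tm : 0 <= t * m%:R by rewrite mulr_ge0 // ltW // (lt_trans ltr01).
rewrite natrD in nt; split.
  have /f_nd : (n - J <= j')%N by lia.
  have := f_ratio (n - J)%N J; rewrite subnK ?natrB; [|lia|lia].
  have := phi_ge0 (ray y (n - J)); have := phi_ge0 (ray y n).
  set u := phi (ray y n); set w := phi (ray y (n - J)) => u0 w0 uw wj.
  have : n%:R * u <= t * (n%:R * w).
    apply: (@le_trans _ _ (t * ((n%:R - J%:R) * u))).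
      by rewrite mulrA ler_wpM2r //; lra.
    by rewrite ler_wpM2l // ltW // (lt_trans ltr01).
  rewrite mulrCA ler_pM2l // => uw'; apply: le_trans uw' _.
  by rewrite ler_pM2l // (lt_trans ltr01).
have /f_nd : (j' <= n + (m + J))%N by lia.
have := f_ratio n (m + J)%N; rewrite !natrD.
have := phi_ge0 (ray y n).
set u := phi (ray y n); set w := phi (ray y (n + (m + J))) => u0 uw wj.
apply: le_trans wj _; rewrite -(ler_pM2l n0); apply: le_trans uw _.
rewrite mulrA ler_wpM2r //; nra.
Qed.

(** Translated ray points tend to 0 uniformly in [y], while the finite set [A] stays away from 0. *)
Lemma ray_avoid (g : thompson R) (A : {fset X R}) :
  exists N : nat, forall (y : X R) j, val y <= 1/2 -> (N <= j)%N ->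
    tact g (ray y j) \notin A.
Proof.
have [J [N gP]] := thompson_ray g.
have [|d d0 dP] := @pos_seq_lbound R [seq val x | x <- A].
  by move=> _ /mapP[x _ ->]; have /andP[] := X_bounds x.
have [M MP] := pow2_small d0.
exists (N + M + J)%N => y j y2 jN.
have [|j' [-> jj' _]] := gP y j y2; first lia.
apply/negP => /(map_f val)/dP; apply/negP; rewrite -ltNge.
apply: le_lt_trans (ray_le j' y2) _; apply: MP; lia.
Qed.

Lemma ray_infimum (c : R) : (forall x, c <= phi x) ->
  (forall e, 0 < e -> exists x, phi x < c + e) ->
  exists y : nat -> X R, forall n,
    val (y n) <= 1/2 /\ phi (ray (y n) n) <= c + n.+1%:R^-1.
Proof.
move=> cphi cinf.
(* The first increment of [phi] along the ray is at most [d n], so [n] steps give at most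
   [c + n.+1 * d n], which is [c + 1 / n.+1]. *)
pose d n : R := n.+1%:R^-1 / n.+1%:R.
have d0 n : 0 < d n by rewrite divr_gt0 ?invr_gt0.
have /choice[y yP] : forall n, exists y : X R, [/\ val y <= 1/2,
    phi (ray y 0) <= c + d n & phi (ray y 1) <= c + d n].
  by move=> n; apply: ray_start.
exists y => n; have [y2 y0 y1] := yP n; split=> //.
have := concave_seq_tangent (fun k => ray_concave phi_sh k y2) 0 n.
rewrite add0n; have := cphi (ray (y n) 0) => c0.
have -> : n.+1%:R^-1 = d n + n%:R * d n.
  by rewrite /d -natr1; field; rewrite natr1.
have n0 : 0 <= n%:R :> R by [].
nra.
Qed.

End RayTranslates.

(** * Asymptotics along the ray segments *)

Lemma lamp_act_rearrangement (R : realType) (phi : X R -> R) (c t : R)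
    (y : nat -> X R) (m : nat) (s : lamplighter R) :
  (forall q, 0 < phi q <= 1) -> superharmonic phi -> (forall x, c <= phi x) ->
  (forall n, val (y n) <= 1/2 /\ phi (ray (y n) n) <= c + n.+1%:R^-1) ->
  1 < t -> \forall n \near \oo, forall k, (k < m)%N ->
    phi (ray (y n) n) / t <=
    rearrangement (pad_values phi
      (lamp_act s [fset ray (y n) (n + val i)%N | i in 'I_m]%fset)) k
    <= t * phi (ray (y n) n).
Proof.
move=> phi01 sh cphi yP t1; have t0 : 0 < t by apply: lt_trans t1.
have phi_ge0 x : 0 <= phi x by case/andP: (phi01 x) => /ltW.
set A := lamps s; set g := walker s.
have [N1 N1P] := ray_translate phi_ge0 sh g m t1.
have [N2 N2P] := ray_avoid g A.
(* These gaps are positive because [t > 1] and [phi x > 0]. Once [1 / n.+1 <= d], a lamp of [A] left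
   in the set has value at least [phi (ray (y n) n) / t]. *)
have [|d d0 dP] := @pos_seq_lbound R [seq t * phi x - c | x <- A].
  move=> _ /mapP[x _ ->]; have /andP[x0 _] := phi01 x.
  by have := cphi x; nra.
have [N3 N3P] := natr_ubound d^-1.
exists (N1 + N2 + N3)%N => // n /= nN k km.
have [y2 yc] := yP n.
have gE i : tact g (ray (y n) (n + val (i : 'I_m))) \in
    lamp_act s [fset ray (y n) (n + val i)%N | i in 'I_m]%fset.
  (* Translated points avoid [A], so the symmetric difference cancels none of them. *)
  rewrite in_fsymdiff (negPf (N2P _ _ y2 _)); last lia.
  by rewrite in_fset_act -tactM mulVg tact1; apply/imfsetP; exists i.
apply: (rearrangement_bounds (e := fun i : 'I_m =>
  tact g (ray (y n) (n + val i)))) km => //.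
- rewrite ler_pdivrMr // mul1r; apply: ltW; apply: le_lt_trans t1.
  by case/andP: (phi01 (ray (y n) n)).
- move=> q; rewrite ler_pdivrMr // mulrC in_fsymdiff.
  have [qA _|_ /=] := boolP (q \in A).
    have nd : n.+1%:R^-1 <= d.
      rewrite invf_ple ?posrE // ltW // N3P //; lia.
    have dq : d <= t * phi q - c by apply: dP; apply: map_f.
    by apply: le_trans yc _; rewrite -lerBrDl (le_trans nd).
  move=> /imfsetP[x /imfsetP[i _ ->] ->].
  by have [] := N1P n (y n) i; rewrite ?ltn_ord //; lia.
- move=> i j /(congr1 (tact g^-1%g)); rewrite -!tactM mulVg !tact1.
  by move=> /(ray_inj y2)/addnI/val_inj.
- move=> i; split; first exact: gE.
  by have [] := N1P n (y n) i; rewrite ?ltn_ord //; lia.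
Qed.

Theorem theorem17 (R : realType) (f : {fset X R} -> R)
    (hf : generalized_min_function f) :
  exists E : nat -> {fset X R}, forall s : lamplighter R,
    (fun n => f (lamp_act s (E n)) / f (E n)) @ \oo --> (1 : R).
Proof.
case: hf => m [r [phi [m0 [r0 _ rconc rnd] [phi01 sh _] fE]]].
have phi_ge0 x : 0 <= phi x by case/andP: (phi01 x) => /ltW.
pose c := inf (range phi).
have cphi x : c <= phi x.
  by apply: ge_inf; [exists 0 => _ [z _ <-]|exists x].
have cinf e : 0 < e -> exists x, phi x < c + e.
  move=> e0; have [|_ [x _ <-] xe] := @inf_adherent R (range phi) e e0.
    split; first by exists (phi (base_point R)), (base_point R).
    by exists 0 => _ [z _ <-].
  by exists x.
have [y yP] := ray_infimum phi_ge0 sh cphi cinf.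
pose E n : {fset X R} := [fset ray (y n) (n + val i)%N | i in 'I_m]%fset.
pose v n := phi (ray (y n) n).
(* Common comparison value: [f (lamp_act s (E n))] is asymptotic to [h n] for every [s], and [s = 1]
   gives the denominator. *)
pose h n := r (const_mx (v n)).
have vC n : cube (const_mx (v n) : 'rV_m) by move=> i; rewrite mxE; apply: phi01.
have h0 n : 0 < h n by apply: r0.
have rearr_cube A : cube (\row_k rearrangement (pad_values phi A) k).
  move=> i; rewrite mxE; have AT := pad_values_T A phi01.
  have [s _ ->] := rearrangement_bij AT.
  by have [xT _] := AT; exact: xT.
have f_h s : (fun n => f (lamp_act s (E n)) / h n) @ \oo --> (1 : R).
  apply/cvgrPdist_le => e e0.
  have t1 : 1 < 1 + e by lra.
  have t0 : 0 < 1 + e by lra.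
  have := lamp_act_rearrangement m s phi01 sh cphi yP t1.
  apply: filterS => n nP.
  have f0 : 0 < f (lamp_act s (E n)) by rewrite fE; apply: r0.
  have fh : f (lamp_act s (E n)) <= (1 + e) * h n.
    rewrite fE; apply: (cube_le r0 rconc rnd) => [||/=|i]; rewrite ?(ltW t1) //.
    by rewrite !mxE; have /andP[] := nP i (ltn_ord i).
  have hf : h n <= (1 + e) * f (lamp_act s (E n)).
    rewrite fE; apply: (cube_le r0 rconc rnd) => [||/=|i]; rewrite ?(ltW t1) //.
    by rewrite !mxE mulrC -ler_pdivrMr //; have /andP[] := nP i (ltn_ord i).
  have := divr_gt0 f0 (h0 n).
  rewrite -ler_pdivrMr // in fh; rewrite -[h n]mul1r -ler_pdivlMr // -mulrA in hf.
  rewrite ler_distl; set q := _ / h n in fh hf * => q0.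
  (* The lower bound is [1 - e <= 1 / (1 + e) <= q]. *)
  by apply/andP; split; nra.
exists E => s.
have -> : (fun n => f (lamp_act s (E n)) / f (E n)) =
    (fun n => (f (lamp_act s (E n)) / h n) * (f (lamp_act 1%g (E n)) / h n)^-1).
  apply/funext => n; rewrite lamp_act1 invf_div mulrA divfK //.
  exact: lt0r_neq0.
rewrite -[X in _ --> X]mulr1 -[X in _ * X]invr1.
by apply: cvgM (f_h s) _; apply: cvgV (f_h 1%g); rewrite oner_eq0.
Qed.
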